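(* Let $m\geq 1$ be an integer, and let $G$ be a connected $\{K_{1,3},B_{1,m}\}$-free graph. Then $G$ is not $P_{\max\{3m,m+4\}}$-free if and only if $G\in\mathcal{P}(\max\{3m,m+4\})$.
   Context: All graphs are finite and simple. A graph is $\mathcal{F}$-free if it contains no member of $\mathcal{F}$ as an induced subgraph. $K_{1,3}$ is the star with three leaves, $P_n$ is the path on $n$ vertices. For $m\geq 1$, $B_{1,m}$ is the graph obtained from a triangle $abc$ by adding a new vertex adjacent only to $a$ and a new path $q_1q_2\cdots q_m$ with $q_1$ adjacent to $b$ (and no other new edges). For an integer $l\geq 5$ and pairwise vertex-disjoint nonempty cliques $L_1,\dots,L_l$, the fat $l$-path $F_p(L_1,\dots,L_l)$ is the graph on $L_1\cup\dots\cup L_l$ in which each $L_i$ is a clique, every vertex of $L_i$ is adjacent to every vertex of $L_{i+1}$ for $1\leq i\leq l-1$, and there are no other edges. For pairwise vertex-disjoint nonempty cliques $L_0,\dots,L_l$, the fat $l$-cycle $F_c(L_0,\dots,L_l)$ is the graph on $L_0\cup\dots\cup L_l$ in which each $L_i$ is a clique, every vertex of $L_i$ is adjacent to every vertex of $L_{i+1}$ for $0\leq i\leq l$ (indices modulo $l+1$), and there are no other edges. For $l\geq 5$, $\mathcal{P}(l)$ denotes the family of all fat $i$-paths and fat $i$-cycles for all $i\geq l$ (membership up to isomorphism). *)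

(* Defs.v *)
From Stdlib Require List.
From mathcomp Require Import all_boot.
Set Implicit Arguments.
Unset Strict Implicit.
Unset Printing Implicit Defensive.

Record sgraph := SGraph {
  vertex :> finType;
  adj : rel vertex;
  adj_sym : symmetric adj;
  adj_irr : irreflexive adj }.
Arguments adj {s}.

Definition nat_adj (n : nat) (e : rel nat) : rel 'I_n :=
  fun x y => (x != y) && (e x y || e y x).

Lemma nat_adj_sym n e : symmetric (@nat_adj n e).
Proof. by move=> x y; rewrite /nat_adj eq_sym orbC. Qed.

Lemma nat_adj_irr n e : irreflexive (@nat_adj n e).
Proof. by move=> x; rewrite /nat_adj eqxx. Qed.

(* The graph on {0, ..., n-1} whose edges are the pairs {x, y}, x <> y, with
   e x y or e y x. *)
Definition nat_graph (n : nat) (e : rel nat) : sgraph :=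
  SGraph (@nat_adj_sym n e) (@nat_adj_irr n e).

Definition path_graph (n : nat) : sgraph :=
  nat_graph n (fun x y => y == x.+1).

Definition K13 : sgraph := nat_graph 4 (fun x _ => x == 0).

(* a = 0, b = 1, c = 2, the vertex pendant at a is 3, and q_i = i + 3. *)
Definition B1 (m : nat) : sgraph :=
  nat_graph (m + 4) (fun x y =>
    ((x, y) \in [:: (0, 1); (0, 2); (1, 2); (0, 3); (1, 4)])
    || ((4 <= x) && (y == x.+1))).

Definition induced_subgraph (H G : sgraph) : Prop :=
  exists2 f : H -> G, injective f & forall x y, adj (f x) (f y) = adj x y.

Definition free (F : seq sgraph) (G : sgraph) : Prop :=
  forall H, List.In H F -> ~ induced_subgraph H G.

Definition connected_graph (G : sgraph) : Prop :=
  0 < #|G| /\ forall x y : G, connect adj x y.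

(* The sets L i are pairwise disjoint nonempty cliques covering G, and for
   i <> j the edges between L i and L j are all present if r i j, and all
   absent otherwise. *)
Definition clique_decomposition (G : sgraph) (k : nat) (r : rel 'I_k)
    (L : 'I_k -> {set G}) : Prop :=
  [/\ forall i, L i != set0,
      forall i j, i != j -> [disjoint L i & L j],
      \bigcup_i L i = [set: G]
    & forall i j (x y : G), x \in L i -> y \in L j ->
        adj x y = (x != y) && ((i == j) || r i j)].

(* The cliques L_1, ..., L_l are indexed by 0, ..., l-1. *)
Definition fat_path (l : nat) (G : sgraph) : Prop :=
  5 <= l /\ exists L : 'I_l -> {set G},
    clique_decomposition (fun i j => (j == i.+1 :> nat) || (i == j.+1 :> nat)) L.

(* A fat l-cycle has l+1 cliques L_0, ..., L_l. *)
Definition fat_cycle (l : nat) (G : sgraph) : Prop :=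
  5 <= l /\ exists L : 'I_l.+1 -> {set G},
    clique_decomposition
      (fun i j => (j == i.+1 %% l.+1 :> nat) || (i == j.+1 %% l.+1 :> nat)) L.

Definition fat_family (l : nat) (G : sgraph) : Prop :=
  exists2 i, l <= i & fat_path i G \/ fat_cycle i G.

(* Main.v *)
From Stdlib Require Import Classical.
Require Import Defs.
From mathcomp Require Import all_boot zify.
Set Implicit Arguments.
Unset Strict Implicit.
Unset Printing Implicit Defensive.

(* Take an induced path P with the maximal number k >= max(3m, m+4) of
   vertices. Claws and copies of B_{1,m} leave only three possible traces on P
   for a vertex v outside P: that of a vertex of P together with its path
   neighbours, one end of P (excluded by maximality of k), or both ends of P,
   in which case P + v is an induced cycle on k+1 vertices. If there is no such
   cycle, every vertex near P is a twin (relative to P) of a vertex of P, and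
   the twin classes form a fat k-path. If there is one, applying the
   classification to all its subpaths on k vertices shows that every vertex
   near the cycle is a twin of one of its vertices, and the twin classes form a
   fat k-cycle. *)

(** * Recognizing claws and copies of $B_{1,m}$ *)

Lemma nat_graph_induced n (e : rel nat) (G : sgraph) (f : nat -> G) :
  (forall i j, i < j < n -> f i != f j /\ adj (f i) (f j) = e i j || e j i) ->
  induced_subgraph (nat_graph n e) G.
Proof.
move=> hf; exists (fun i : 'I_n => f i) => [i j | i j] /=.
  move=> eq_f; apply/val_inj; case: (ltngtP i j) => // lt_ij.
    by have [] := hf i j; rewrite ?lt_ij ?ltn_ord // eq_f eqxx.
  by have [] := hf j i; rewrite ?lt_ij ?ltn_ord // eq_f eqxx.
rewrite /nat_adj -val_eqE /=; case: (ltngtP i j) => [lt_ij | lt_ji | ->].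
- by have [] := hf i j; rewrite ?lt_ij ?ltn_ord.
- by rewrite adj_sym orbC; have [] := hf j i; rewrite ?lt_ji ?ltn_ord.
- exact: adj_irr.
Qed.

Lemma adj_neq (G : sgraph) (u v : G) : adj u v -> u != v.
Proof. by apply: contraTneq => ->; rewrite adj_irr. Qed.

Lemma claw_free (G : sgraph) (c x y z : G) : ~ induced_subgraph K13 G ->
  adj c x -> adj c y -> adj c z -> ~~ adj x y -> ~~ adj x z -> ~~ adj y z ->
  x != y -> x != z -> y != z -> False.
Proof.
move=> claw cx cy cz /negbTE xy /negbTE xz /negbTE yz nxy nxz nyz; apply: claw.
apply: (@nat_graph_induced _ _ _ (nth c [:: c; x; y; z])) => i j.
by case: i j => [|[|[|[|i]]]] [|[|[|[|j]]]] /andP[//= _ _]; split;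
  rewrite ?cx ?cy ?cz ?xy ?xz ?yz ?adj_neq.
Qed.

(** Indexing by all naturals, with values from [k] on left free, lets paths be reversed, extended
    and shifted without casts between ordinals. *)
Definition induced_path (G : sgraph) (k : nat) (p : nat -> G) : Prop :=
  forall i j, i < k -> j < k ->
    (p i == p j) = (i == j) /\
    adj (p i) (p j) = (j == i.+1) || (i == j.+1).

Lemma induced_path_adj (G : sgraph) k (p : nat -> G) : induced_path k p ->
  forall i j, i < k -> j < k -> adj (p i) (p j) = (j == i.+1) || (i == j.+1).
Proof. by move=> hp i j ik jk; case: (hp i j ik jk). Qed.

Lemma induced_path_rev (G : sgraph) k (p : nat -> G) :
  induced_path k p -> induced_path k (fun i => p (k.-1 - i)).
Proof.
move=> hp i j ik jk; have [||-> ->] := hp (k.-1 - i) (k.-1 - j); lia.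
Qed.

(** The triangle is [a], [b], [c], the pendant vertex at [a] is [d], and the path leaving [b] is the
    stretch of [p] that goes up from [p s]. *)
Lemma B1_tail (G : sgraph) m k s (p : nat -> G) (a b c d : G) :
  ~ induced_subgraph (B1 m) G -> induced_path k p -> s + m <= k ->
  adj a b -> adj a c -> adj b c -> adj a d -> ~~ adj b d -> ~~ adj c d ->
  (forall i, s <= i < s + m ->
     [/\ ~~ adj a (p i), adj b (p i) = (i == s),
         ~~ adj c (p i) & ~~ adj d (p i)]) -> False.
Proof.
move=> noB hp smk ab ac bc ad /negbTE bd /negbTE cd hq; apply: noB.
(* Distinctness of the vertices is read off from adjacency to a third vertex. *)
have sep (w x y : G) : adj w x -> adj w y = false -> x != y.
  by move=> wx wy; apply: contraFneq wy => <-.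
(* The default value of [nth] supplies the tail, from index 4 on. *)
pose f i := nth (p (s + (i - 4))) [:: a; b; c; d] i.
apply: (@nat_graph_induced _ _ _ f) => i j /andP[ltij ltj].
have fq i' : 4 <= i' -> f i' = p (s + (i' - 4)).
  by move=> ge4; rewrite /f nth_default.
have [lt4|ge4] := ltnP j 4.
  case: i j ltij ltj lt4 => [|[|[|[|i]]]] [|[|[|[|j]]]] //= _ _ _; rewrite /f /=.
  - by rewrite ab adj_neq.
  - by rewrite ac adj_neq.
  - by rewrite ad adj_neq.
  - by rewrite bc adj_neq.
  - by rewrite bd (sep c) // adj_sym.
  - by rewrite cd (sep b).
rewrite (fq j) //.
have [|/negbTE aq bq /negbTE cq /negbTE dq] := hq (s + (j - 4)); first by lia.
have ca : adj c a by rewrite adj_sym.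
case: j ltij ltj ge4 fq aq bq cq dq => [|[|[|[|j]]]] // ltij ltj _ fq aq bq cq dq.
case: i ltij => [|[|[|[|i]]]] // ltij; rewrite !inE !xpair_eqE /=.
- by rewrite /f /= aq (sep c).
- by rewrite /f /= bq (sep a) //; split=> //; clear; lia.
- by rewrite /f /= cq (sep a).
- by rewrite /f /= dq (sep a).
rewrite (fq i.+4) //; have [||-> ->] := hp (s + (i.+4 - 4)) (s + (j.+4 - 4)).
1-3: by move: smk ltij ltj; clear; lia.
Qed.

(** Here the tail goes down from [p s] and has [m] vertices because [m <= s.+1]. *)
Lemma B1_tail_rev (G : sgraph) m k s (p : nat -> G) (a b c d : G) :
  ~ induced_subgraph (B1 m) G -> induced_path k p -> m <= s.+1 -> s < k ->
  adj a b -> adj a c -> adj b c -> adj a d -> ~~ adj b d -> ~~ adj c d ->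
  (forall i, s < i + m -> i <= s ->
     [/\ ~~ adj a (p i), adj b (p i) = (i == s),
         ~~ adj c (p i) & ~~ adj d (p i)]) -> False.
Proof.
move=> noB hp ms sk ab ac bc ad bd cd hq.
apply: (B1_tail (s := k.-1 - s) noB (induced_path_rev hp) _ ab ac bc ad bd cd).
  by lia.
move=> i hi; have [||? -> ? ?] := hq (k.-1 - i); try lia.
by split=> //; lia.
Qed.

(** * Traces on an induced path *)

Lemma adj_flip (G : sgraph) k (p : nat -> G) (v : G) (N : pred nat) :
  (forall i, i < k -> adj v (p i) = N i) ->
  forall i, i < k -> adj (p i) v = N i.
Proof. by move=> hv i ik; rewrite adj_sym hv. Qed.

Ltac nbhd_lia hp hv :=
  try (match goal with |- forall i, _ => intros; split end);
  rewrite ?(induced_path_adj hp) ?hv ?(adj_flip hv) /=; clear hp hv; lia.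

(** The triangle is [v], [p x], [p x.+1]. Of the [k - 2] other path vertices at least [m] lie on one
    side and form the tail; the pendant vertex is the path neighbour on the other side. *)
Lemma no_inner_pair (G : sgraph) m k (p : nat -> G) v x :
  ~ induced_subgraph (B1 m) G -> 2 * m < k ->
  induced_path k p -> 0 < x -> x.+2 < k ->
  (forall i, i < k -> adj v (p i) = (i == x) || (i == x.+1)) -> False.
Proof.
move=> noB mk hp x0 xk hv.
have [h|h] := leqP (x.+2 + m) k.
  apply: (@B1_tail _ m k x.+2 p (p x) (p x.+1) v (p x.-1)) => //;
    nbhd_lia hp hv.
apply: (@B1_tail_rev _ m k x.-1 p (p x.+1) (p x) v (p x.+2)) => //;
  nbhd_lia hp hv.
Qed.

(** If the interval touches an end of the path, [v] carries the pendant vertex and the tail runs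
    towards the other end. Otherwise the triangle sits at one end of the interval and the tail
    leaves it through [v], starting at the other end of the interval. *)
Lemma no_four_interval (G : sgraph) m k (p : nat -> G) v x :
  ~ induced_subgraph (B1 m) G -> 2 * m < k -> m + 4 <= k ->
  induced_path k p -> x + 3 < k ->
  (forall i, i < k -> adj v (p i) = (x <= i <= x + 3)) -> False.
Proof.
move=> noB mk mk4 hp xk hv.
have [x0|x0] := posnP x.
  apply: (@B1_tail _ m k 4 p v (p 3) (p 2) (p 0)) => //;
    nbhd_lia hp hv.
have [xk4|xk4] := eqVneq (x + 4) k.
  apply: (@B1_tail_rev _ m k x.-1 p v (p x) (p x.+1) (p (x + 3))) => //;
    nbhd_lia hp hv.
have [h|h] := leqP (x + 3 + m) k.
  apply: (@B1_tail _ m k (x + 3) p (p x) v (p x.+1) (p x.-1)) => //;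
    nbhd_lia hp hv.
apply: (@B1_tail_rev _ m k x p (p (x + 3)) v (p x.+2) (p (x + 4))) => //;
  nbhd_lia hp hv.
Qed.

(** The bound [3 * m <= k] leaves room for a tail in one of three places: from [y] upwards, from [x]
    downwards, or between the two pairs. The first two tails are reached through [v]. *)
Lemma no_two_pairs (G : sgraph) m k (p : nat -> G) v x y :
  ~ induced_subgraph (B1 m) G -> 3 * m <= k ->
  induced_path k p -> x + 4 <= y -> y < k ->
  (forall i, i < k -> adj v (p i) = [|| i == x, i == x.+1, i == y.-1 | i == y]) ->
  False.
Proof.
move=> noB mk hp xy yk hv.
have [h|h] := leqP (y + m) k.
  apply: (@B1_tail _ m k y p (p x.+1) v (p x) (p x.+2)) => //;
    nbhd_lia hp hv.
have [h'|h'] := leqP m x.+1.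
  apply: (@B1_tail_rev _ m k x p (p y.-1) v (p y) (p y.-2)) => //;
    nbhd_lia hp hv.
apply: (@B1_tail _ m k x.+2 p v (p x.+1) (p x) (p y)) => //;
  nbhd_lia hp hv.
Qed.

(** The tail runs above [y], or below [y.-1] while staying clear of [p 1], or starts at [p 0] and is
    reached through [v]. In the last case [y <= m + 2], so [m + 4 <= k] provides the pendant vertex
    [p y.+1], and [k - m <= y] keeps the tail away from [p y.-1]. *)
Lemma no_end_and_pair (G : sgraph) m k (p : nat -> G) v y :
  ~ induced_subgraph (B1 m) G -> 0 < m -> 3 * m <= k -> m + 4 <= k ->
  induced_path k p -> 3 <= y -> y < k ->
  (forall i, i < k -> adj v (p i) = [|| i == 0, i == y.-1 | i == y]) ->
  False.
Proof.
move=> noB m0 mk mk4 hp y3 yk hv.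
have [h|h] := leqP (y.+1 + m) k.
  apply: (@B1_tail _ m k y.+1 p v (p y) (p y.-1) (p 0)) => //;
    nbhd_lia hp hv.
have [h'|h'] := leqP (m + 3) y.
  apply: (@B1_tail_rev _ m k y.-2 p v (p y.-1) (p y) (p 0)) => //;
    nbhd_lia hp hv.
apply: (@B1_tail _ m k 0 p (p y) v (p y.-1) (p y.+1)) => //;
  nbhd_lia hp hv.
Qed.

(** Let [x] and [y] be the first and last neighbours of [v] on the path. Claws centred at [v]
    confine the neighbours to [x], [x.+1], [y.-1], [y], and claws centred on the path force a
    neighbour with no neighbour beside it to be an end. The few remaining traces are settled by the
    lemmas on $B_{1,m}$. *)
Lemma path_nbhd (G : sgraph) m k (p : nat -> G) (v : G) :
  ~ induced_subgraph K13 G -> ~ induced_subgraph (B1 m) G ->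
  0 < m -> 3 * m <= k -> m + 4 <= k -> induced_path k p ->
  (forall i, i < k -> v != p i) -> (exists2 i, i < k & adj v (p i)) ->
  [\/ exists2 t, t < k &
        forall j, j < k -> adj v (p j) = [|| t == j, j == t.+1 | t == j.+1],
      forall j, j < k -> adj v (p j) = (j == 0) || (j == k.-1),
      forall j, j < k -> adj v (p j) = (j == 0)
    | forall j, j < k -> adj v (p j) = (j == k.-1)].
Proof.
move=> noK noB m0 mk3 mk4 hp vp exN.
pose N i := adj v (p i).
have eN i : adj v (p i) = N i by [].
have pp := induced_path_adj hp.
have pneq i j : i < k -> j < k -> i != j -> p i != p j.
  by move=> ik jk; have [-> _] := hp i j ik jk.
have claw i : 0 < i -> i.+1 < k -> N i -> ~~ N i.-1 -> ~~ N i.+1 -> False.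
  move=> i0 ik Ni Np Ns.
  apply: (claw_free noK (c := p i) (x := p i.-1) (y := p i.+1) (z := v));
    rewrite ?pp ?pneq -1?(eq_sym v) ?vp // 1?adj_sym //; clear -i0 ik; lia.
have triple i j l : i.+1 < j -> j.+1 < l -> l < k -> N i -> N j -> N l -> False.
  move=> ij jl lk Ni Nj Nl.
  by apply: (claw_free noK (c := v) (x := p i) (y := p j) (z := p l));
    rewrite ?pp ?pneq //; clear -ij jl lk; lia.
pose Q i := (i < k) && N i.
have exQ : exists i, Q i by case: exN => i ik Ni; exists i; rewrite /Q ik.
have leQ i : Q i -> i <= k by case/andP=> /ltnW.
case: (ex_minnP exQ) => x /andP[xk Nx] minx.
case: (ex_maxnP exQ leQ) => y /andP[yk Ny] maxy.
have xy : x <= y by apply: minx; rewrite /Q yk.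
(* Any other neighbour would be independent from [p x] and [p y], giving a claw at [v]. *)
have NE j : x < y -> j < k ->
    N j = [|| j == x, (j == x.+1) && N x.+1, (j == y.-1) && N y.-1 | j == y].
  move=> ltxy jk; apply/idP/idP => [Nj|]; last first.
    by case/or4P=> [/eqP->|/andP[/eqP-> ]|/andP[/eqP-> ]|/eqP->].
  have xj : x <= j by apply: minx; rewrite /Q jk.
  have jy : j <= y by apply: maxy; rewrite /Q jk.
  case: eqVneq => //= jx; case: eqVneq => [<-|/= jx1]; first by rewrite Nj.
  case: eqVneq => [<-|/= jy1]; first by rewrite Nj.
  case: eqVneq => //= jy0.
  by case: (triple x j y) => //; clear -xj jy jx jx1 jy1 jy0; lia.
have out j : j < k -> (j < x) || (y < j) -> N j = false.
  move=> jk jout; apply/negP=> Nj.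
  have := minx j; have := maxy j; rewrite /Q jk Nj.
  by move=> /(_ isT) jy /(_ isT) xj; move: jy xj jout; clear; lia.
have [eqxy|nexy] := eqVneq x y.
  subst y; have Nj j : j < k -> N j = (j == x).
    by move=> jk; case: (ltngtP j x) => [jx|jx|->] //; rewrite out // jx ?orbT.
  have [x0|x0] := posnP x; first by apply: Or43 => j /Nj; rewrite x0.
  have [xk1|xk1] := eqVneq x k.-1; first by apply: Or44 => j /Nj; rewrite xk1.
  by case: (claw x) => //; rewrite ?Nj //; clear -xk x0 xk1; lia.
have ltxy : x < y by rewrite ltn_neqAle nexy.
have [y1|ny1] := eqVneq y x.+1.
  subst y.
  have hv j : j < k -> adj v (p j) = (j == x) || (j == x.+1).
    by move=> jk; rewrite eN NE //= Nx Ny; clear; lia.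
  have [x0|x0] := posnP x.
    by apply: Or41; exists 0 => // [|j jk]; rewrite ?hv //; clear -x0 xk; lia.
  have [xk1|xk1] := eqVneq x.+2 k.
    by apply: Or41; exists x.+1 => // j jk; rewrite hv //; clear -xk1 jk; lia.
  case: (no_inner_pair noB _ hp _ _ hv) => //; clear -xk1 x0 mk3 mk4 yk; lia.
have left1 : ~~ N x.+1 -> x = 0.
  move=> Nx1; have [//|x0] := posnP x; case: (claw x) => //.
    by clear -ltxy yk; lia.
  by rewrite out //; clear -x0 xk; lia.
have right1 : ~~ N y.-1 -> y = k.-1.
  move=> Ny1; have [//|yk1] := eqVneq y k.-1; case: (claw y) => //.
  - by clear -ltxy; lia.
  - by clear -yk yk1; lia.
  - by rewrite out //; clear -yk yk1; lia.
have [y2|ny2] := eqVneq y x.+2.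
  subst y; case Nx1: (N x.+1).
    apply: Or41; exists x.+1; first by clear -yk; lia.
    by move=> j jk; rewrite eN NE //= Nx1; clear; lia.
  (* Both neighbours would be ends of the path, so [k] would be 3. *)
  have x0 := left1 (negbT Nx1); have := right1 (negbT Nx1).
  by clear -x0 mk4 m0; lia.
have y3 : x + 3 <= y by clear -ltxy ny1 ny2; lia.
case Nx1: (N x.+1); case Ny1: (N y.-1).
- have [y4|ny4] := eqVneq y (x + 3).
    subst y; case: (@no_four_interval G m k p v x) => //; try by clear -mk3 m0; lia.
    by move=> j jk; rewrite eN NE // Nx1 Ny1; clear; lia.
  case: (@no_two_pairs G m k p v x y) => //; first by clear -y3 ny4; lia.
  by move=> j jk; rewrite eN NE // Nx1 Ny1; clear; lia.
- have yE := right1 (negbT Ny1).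
  (* Reversal moves the isolated neighbour from the last index to 0. *)
  case: (@no_end_and_pair G m k (fun i => p (k.-1 - i)) v (k.-1 - x)) => //.
  + exact: induced_path_rev.
  + by clear -y3 yE; lia.
  + by clear -yk; lia.
  + move=> j jk; rewrite eN NE // ?Nx1 ?Ny1; clear -jk y3 yE xk; lia.
- have x0 := left1 (negbT Nx1); subst x.
  case: (@no_end_and_pair G m k p v y) => //.
  by move=> j jk; rewrite eN NE // Nx1 Ny1; clear; lia.
- have x0 := left1 (negbT Nx1); have yE := right1 (negbT Ny1); subst x.
  by apply: Or42 => j jk; rewrite eN NE // Nx1 Ny1 -yE; clear; lia.
Qed.

(** * Twin classes of a pattern *)

(** Counting equality as adjacency gives a pattern vertex the same trace as its adjacent twins. *)
Definition closed_adj (G : sgraph) (u v : G) : bool := (u == v) || adj u v.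

Lemma closed_adj_sym (G : sgraph) : symmetric (@closed_adj G).
Proof. by move=> u v; rewrite /closed_adj eq_sym adj_sym. Qed.

Lemma adjE (G : sgraph) (u v : G) : adj u v = (u != v) && closed_adj u v.
Proof. by rewrite /closed_adj; case: eqVneq => [->|]; rewrite ?adj_irr. Qed.

(** Injectivity is not demanded: it follows once distinct rows of [e] differ. *)
Definition realizes (G : sgraph) (I : finType) (e : rel I) (p : I -> G) : Prop :=
  forall i j, closed_adj (p i) (p j) = e i j.

Definition twin_free (I : Type) (e : rel I) : Prop :=
  forall i j, (forall l, e i l = e j l) -> i = j.

Lemma realizes_inj (G : sgraph) (I : finType) (e : rel I) (p : I -> G) :
  twin_free e -> realizes e p -> injective p.
Proof. by move=> tw hp i j pij; apply: tw => l; rewrite -!hp pij. Qed.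

Definition replace (T : Type) (I : eqType) (p : I -> T) i v : I -> T :=
  fun l => if l == i then v else p l.

Lemma realizes_replace (G : sgraph) (I : finType) (e : rel I) (p : I -> G) i v :
  symmetric e -> realizes e p -> (forall l, closed_adj v (p l) = e i l) ->
  realizes e (replace p i v).
Proof.
move=> syme hp hv a b; rewrite /replace.
case: eqVneq => [->|na]; case: eqVneq => [->|nb] //.
- by rewrite -(hp i i) /closed_adj !eqxx.
- by rewrite closed_adj_sym hv syme.
Qed.

Definition refl_closure (I : eqType) (r : rel I) : rel I :=
  fun i j => (i == j) || r i j.

(* A vertex whose trace on a copy [p] of the pattern equals that of [p i] may
   replace [p i]; classifying the other vertices against the new copy decides
   adjacency inside and between the twin classes, and shows that every vertex
   has a neighbour on [p]. *)
Lemma twin_decomposition (G : sgraph) K (r : rel 'I_K) :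
  let e := refl_closure r in
  'I_K -> connected_graph G -> symmetric e -> twin_free e ->
  (forall i, exists2 l, l != i & e i l) ->
  (forall i j s t,
     (forall l, l != i -> e s l = e j l) -> e s i = ~~ e j i ->
     (forall l, l != j -> e t l = e i l) -> e t j = ~~ e i j -> False) ->
  (forall p : 'I_K -> G, realizes e p ->
     forall v, (exists j, closed_adj v (p j)) ->
     exists i, forall j, closed_adj v (p j) = e i j) ->
  (exists p : 'I_K -> G, realizes e p) ->
  exists L : 'I_K -> {set G}, clique_decomposition r L.
Proof.
move=> e i0 [_ conn] syme tw nbr swap cls [p hp].
have ee i : e i i by rewrite /e /refl_closure eqxx.
have repl := realizes_replace syme hp.
have twins u v i j : (forall l, closed_adj u (p l) = e i l) ->
    (forall l, closed_adj v (p l) = e j l) -> closed_adj u v = e i j.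
  (* Put [u'] in place of [p i'] and classify [v'] again: its new row [s] agrees with row [j'] off
     [i'], and at [i'] it records adjacency to [u']. *)
  have half u' v' i' j' : (forall l, closed_adj u' (p l) = e i' l) ->
      (forall l, closed_adj v' (p l) = e j' l) ->
      exists2 s, (forall l, l != i' -> e s l = e j' l) & e s i' = closed_adj v' u'.
    move=> hu hv; have [|s hs] := cls _ (repl _ _ hu) v'.
      have [eji|neji] := eqVneq j' i'; last first.
        by exists j'; rewrite /replace (negbTE neji) hv.
      by have [l /negbTE li il] := nbr i'; exists l; rewrite /replace li hv eji.
    exists s; last by rewrite -hs /replace eqxx.
    by move=> l /negbTE li; rewrite -hs /replace li hv.
  move=> hu hv; have [//|neq] := eqVneq (closed_adj u v) (e i j).
  (* A wrong adjacency would change row [j] exactly at [i] and row [i] exactly at [j], both results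
     being rows again; this is what [swap] forbids. *)
  have neqb : closed_adj u v = ~~ e i j by case: (closed_adj u v) (e i j) neq => [] [].
  have [s hs si] := half u v i j hu hv; have [t ht tj] := half v u j i hv hu.
  case: (swap i j s t) => //; first by rewrite si closed_adj_sym neqb syme.
  by rewrite tj.
(* The vertices seeing the copy are closed under adjacency, hence are all of [G] by
   connectedness. *)
pose A := [pred v | [exists j, closed_adj v (p j)]].
have clA v w : adj v w -> v \in A -> w \in A.
  move=> vw /existsP/(cls p hp)[i hi]; apply/existsP.
  have [|s hs] := cls _ (repl _ _ hi) w.
    by exists i; rewrite /replace eqxx closed_adj_sym /closed_adj vw orbT.
  have [l li sl] : exists2 l, l != i & e s l.
    by have [si|si] := eqVneq s i; [rewrite si; apply: nbr | exists s].
  by exists l; move: (hs l); rewrite /replace (negbTE li) sl.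
have csym : connect_sym (@adj G).
  by apply: sym_connect_sym => x y; rewrite adj_sym.
have typed v : exists i, forall j, closed_adj v (p j) = e i j.
  apply: cls => //; apply/existsP; rewrite -[X in is_true X]/(v \in A).
  rewrite -(closed_connect (intro_closed csym clA) (conn (p i0) v)).
  by apply/existsP; exists i0; rewrite hp.
exists (fun i => [set v | [forall j, closed_adj v (p j) == e i j]]).
have LP i v : reflect (forall j, closed_adj v (p j) = e i j)
    (v \in [set v | [forall j, closed_adj v (p j) == e i j]]).
  by rewrite inE; apply: (iffP forallP) => h j; apply/eqP.
split.
- by move=> i; apply/set0Pn; exists (p i); apply/LP.
- move=> i j; apply: contraNT; rewrite -setI_eq0 => /set0Pn[v /setIP[/LP hi /LP hj]].
  by apply/eqP/tw => l; rewrite -hi -hj.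
- apply/setP=> v; rewrite [RHS]inE; apply/bigcupP.
  by have [i hi] := typed v; exists i => //; apply/LP.
- by move=> i j x y /LP hx /LP hy; rewrite adjE (twins _ _ _ _ hx hy).
Qed.

(** * Rows of the path and cycle patterns *)

Definition path_rel k : rel 'I_k :=
  fun i j => (j == i.+1 :> nat) || (i == j.+1 :> nat).

Definition cycle_rel k : rel 'I_k :=
  fun i j => (j == i.+1 %% k :> nat) || (i == j.+1 %% k :> nat).

Lemma path_relE k (i j : 'I_k) : refl_closure (@path_rel k) i j =
  [|| i == j :> nat, j == i.+1 :> nat | i == j.+1 :> nat].
Proof. by []. Qed.

(** If [a] and [b] are not consecutive, the rows disagree at both [a] and [b]. If they are, the
    disagreements are at [a.-1] and [a.+2], as far as these exist. *)
Lemma path_row_diff k (a b i : nat)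
    (R := fun x y => [|| x == y, y == x.+1 | x == y.+1]) :
  a < b < k -> (forall l, l < k -> l != i -> R a l = R b l) ->
  b = a.+1 /\ (a = 0 \/ i = a.-1) /\ (a.+2 = k \/ i = a.+2).
Proof.
move=> /andP[ab bk] h; have ba : b = a.+1.
  have [ai|ai] := eqVneq a i.
    by have := h b bk; move: ai ab; rewrite /R; clear; lia.
  by have := h a (ltn_trans ab bk) ai; move: ab; rewrite /R; clear; lia.
subst b; split=> //; split.
  have [->|a0] := posnP a; [by left | right].
  have [//|ai] := eqVneq i a.-1.
  by have := h a.-1; rewrite eq_sym ai /R; move: a0 bk; clear; lia.
have [->|ak] := eqVneq a.+2 k; [by left | right].
have [//|ai] := eqVneq i a.+2.
by have := h a.+2; rewrite eq_sym ai /R; move: ak bk; clear; lia.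
Qed.

Lemma path_twin_free k : 2 < k -> twin_free (refl_closure (@path_rel k)).
Proof.
move=> k2 i j hij; apply/val_inj => /=.
have ik := ltn_ord i; have jk := ltn_ord j.
(* Rows agreeing everywhere agree off the out-of-range index [k]. *)
case: (ltngtP i j) => // ltij.
  case: (@path_row_diff k i j k) => [|l lk _|]; rewrite ?ltij //;
    last by clear -k2 ik jk; lia.
  exact: (hij (Ordinal lk)).
case: (@path_row_diff k j i k) => [|l lk _|]; rewrite ?ltij //;
    last by clear -k2 ik jk; lia.
exact: (esym (hij (Ordinal lk))).
Qed.

Lemma path_rel_nbr k (i : 'I_k) : 1 < k ->
  exists2 l, l != i & refl_closure (@path_rel k) i l.
Proof.
move=> k1; have ik := ltn_ord i; have [i0|i0] := posnP i.
  by exists (Ordinal k1); rewrite -?val_eqE /= ?path_relE i0.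
have lk : i.-1 < k by lia.
exists (Ordinal lk); [rewrite -val_eqE | rewrite path_relE];
  by move: i0; clear=> /=; lia.
Qed.

(** Two rows differing in one place belong to the last two vertices at one end of the path, and the
    place is the third vertex from that end. *)
Lemma path_row_swap k (i j s : 'I_k) (e := refl_closure (@path_rel k)) : 4 < k ->
  (forall l, l != i -> e s l = e j l) -> e s i = ~~ e j i ->
  i = 2 :> nat /\ j <= 1 \/ i + 3 = k /\ k <= j + 2.
Proof.
move=> k4 hsj hi; have sk := ltn_ord s; have jk := ltn_ord j.
case: (ltngtP s j) => [ltsj|ltjs|/val_inj eqsj].
- case: (@path_row_diff k s j i) => [|l lk li|]; rewrite ?ltsj //.
    exact: (hsj (Ordinal lk)).
  by move: k4 jk; clear; lia.
- case: (@path_row_diff k j s i) => [|l lk li|]; rewrite ?ltjs //.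
    exact: (esym (hsj (Ordinal lk) li)).
  by move: k4 sk; clear; lia.
- by move: hi; rewrite eqsj; case: (e j i).
Qed.

(* The cyclic relation on [0, k) without modular arithmetic. *)
Definition cycle_near k i j :=
  [|| i == j, j == i.+1, i == j.+1,
      (i == 0) && (j == k.-1) | (j == 0) && (i == k.-1)].

Lemma cycle_relE k (i j : 'I_k) :
  refl_closure (@cycle_rel k) i j = cycle_near k i j.
Proof.
rewrite /refl_closure /cycle_rel /cycle_near -val_eqE /=.
have modS (a : 'I_k) : a.+1 %% k = if a.+1 == k then 0 else a.+1.
  by have := ltn_ord a; case: eqP => [->|ne lt]; rewrite ?modnn // modn_small; lia.
rewrite !modS; have := ltn_ord i; have := ltn_ord j.
by clear; case: ifP; case: ifP; lia.
Qed.

Lemma cycle_row_diff k (i j : 'I_k) (e := refl_closure (@cycle_rel k)) : 4 < k ->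
  i != j -> exists l, e i l && ~~ e j l.
Proof.
move=> k4; rewrite -val_eqE /= => ij; have ik := ltn_ord i; have jk := ltn_ord j.
suff [l lk hl] : exists2 l, l < k & cycle_near k i l && ~~ cycle_near k j l.
  by exists (Ordinal lk); rewrite /e !cycle_relE.
have [ji|ji] := boolP (cycle_near k j i); last first.
  by exists i => //; rewrite ji /cycle_near eqxx.
(* For adjacent [i] and [j], the witness is the neighbour of [i] on the side away from [j]. *)
have [jS|jS] := boolP ((j == i.+1 :> nat) || (i == k.-1 :> nat) && (j == 0 :> nat)).
  exists (if i == 0 :> nat then k.-1 else i.-1); first by case: ifP; lia.
  by move: ji jS; rewrite /cycle_near; case: ifP; lia.
exists (if i == k.-1 :> nat then 0 else i.+1); first by case: ifP; lia.
by move: ji jS; rewrite /cycle_near; case: ifP; lia.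
Qed.

Lemma cycle_twin_free k : 4 < k -> twin_free (refl_closure (@cycle_rel k)).
Proof.
move=> k4 i j hij; have [//|/(cycle_row_diff k4)[l]] := eqVneq i j.
by rewrite hij andbN.
Qed.

(** Neither of two distinct rows contains the other, so they differ in at least two places. *)
Lemma cycle_row_swap k (i j s : 'I_k) (e := refl_closure (@cycle_rel k)) : 4 < k ->
  (forall l, l != i -> e s l = e j l) -> e s i = ~~ e j i -> False.
Proof.
move=> k4 hsj hi.
have sj : s != j by apply/eqP => sj; move: hi; rewrite sj; case: (e j i).
have [l /andP[sl jl]] : exists l, e s l && ~~ e j l by apply: cycle_row_diff.
have [l' /andP[jl' sl']] : exists l', e j l' && ~~ e s l'.
  by apply: cycle_row_diff; rewrite // eq_sym.
have li : l = i by have [//|/hsj] := eqVneq l i; rewrite sl (negbTE jl).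
have li' : l' = i by have [//|/hsj] := eqVneq l' i; rewrite jl' (negbTE sl').
by subst l l'; move: jl; rewrite jl'.
Qed.

Lemma cycle_rel_nbr k (i : 'I_k) : 1 < k ->
  exists2 l, l != i & refl_closure (@cycle_rel k) i l.
Proof.
move=> k1; have ik := ltn_ord i; have [i0|i0] := posnP i.
  by exists (Ordinal k1); [rewrite -val_eqE | rewrite cycle_relE]; rewrite /= i0.
have lk : i.-1 < k by lia.
exists (Ordinal lk); [rewrite -val_eqE | rewrite cycle_relE /cycle_near];
  by move: i0; clear=> /=; lia.
Qed.

Lemma refl_closure_sym (I : eqType) (r : rel I) :
  symmetric r -> symmetric (refl_closure r).
Proof. by move=> rs i j; rewrite /refl_closure eq_sym rs. Qed.

Lemma path_rel_sym k : symmetric (@path_rel k).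
Proof. by move=> i j; rewrite /path_rel orbC. Qed.

Lemma cycle_rel_sym k : symmetric (@cycle_rel k).
Proof. by move=> i j; rewrite /cycle_rel orbC. Qed.

Lemma induced_path_snoc (G : sgraph) k (p : nat -> G) (v : G) :
  induced_path k p -> (forall i, i < k -> v != p i) ->
  (forall j, j < k -> adj v (p j) = (j == k.-1)) ->
  induced_path k.+1 (fun i => if i < k then p i else v).
Proof.
move=> hp vp hv i j; rewrite !ltnS => ik jk.
case: (ltnP i k) => ik'; case: (ltnP j k) => jk'; first exact: hp.
- by rewrite eq_sym (negbTE (vp i _)) // adj_sym hv //; clear -ik jk ik' jk'; lia.
- by rewrite (negbTE (vp j _)) // hv //; clear -ik jk ik' jk'; lia.
- by rewrite eqxx adj_irr; clear -ik jk ik' jk'; lia.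
Qed.

Lemma cycle_close (G : sgraph) k (p : nat -> G) (v : G) :
  induced_path k p -> (forall i, i < k -> v != p i) ->
  (forall j, j < k -> adj v (p j) = (j == 0) || (j == k.-1)) ->
  realizes (refl_closure (@cycle_rel k.+1))
    (fun i : 'I_k.+1 => if i < k then p i else v).
Proof.
move=> hp vp hv i j; rewrite cycle_relE /cycle_near /closed_adj.
have := ltn_ord i; have := ltn_ord j; rewrite !ltnS => jk ik.
case: (ltnP i k) => ik'; case: (ltnP j k) => jk'.
- by have [-> ->] := hp i j ik' jk'; clear -ik' jk'; lia.
- by rewrite eq_sym (negbTE (vp i _)) // adj_sym hv //; clear -ik jk ik' jk'; lia.
- by rewrite (negbTE (vp j _)) // hv //; clear -ik jk ik' jk'; lia.
- by rewrite eqxx; clear -ik jk ik' jk'; lia.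
Qed.

Lemma induced_path_realizes (G : sgraph) k (p : nat -> G) :
  induced_path k p -> realizes (refl_closure (@path_rel k)) (fun i : 'I_k => p i).
Proof.
by move=> hp i j; rewrite path_relE /closed_adj; have [||-> ->] := hp i j.
Qed.

Lemma realizes_induced_path (G : sgraph) k (p : 'I_k.+1 -> G) : 2 < k.+1 ->
  realizes (refl_closure (@path_rel k.+1)) p ->
  induced_path k.+1 (fun i => p (inord i)).
Proof.
move=> k2 hp i j ik jk; have pinj := realizes_inj (path_twin_free k2) hp.
rewrite adjE hp path_relE !(inj_eq pinj) -!val_eqE /= !inordK //.
by split=> //; clear; lia.
Qed.

Lemma path_nbhd_maximal (G : sgraph) m k (p : nat -> G) (v : G) :
  ~ induced_subgraph K13 G -> ~ induced_subgraph (B1 m) G ->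
  0 < m -> 3 * m <= k -> m + 4 <= k -> induced_path k p ->
  ~ (exists q : nat -> G, induced_path k.+1 q) ->
  (forall i, i < k -> v != p i) -> (exists2 i, i < k & adj v (p i)) ->
  (exists2 t, t < k &
     forall j, j < k -> adj v (p j) = [|| t == j, j == t.+1 | t == j.+1]) \/
  (forall j, j < k -> adj v (p j) = (j == 0) || (j == k.-1)).
Proof.
move=> noK noB m0 mk3 mk4 hp maxk vp exN.
case: (path_nbhd noK noB m0 mk3 mk4 hp vp exN); [by left | by right | | ].
- move=> hv; case: maxk.
  exists (fun i => if i < k then p (k.-1 - i) else v).
  apply: induced_path_snoc; first exact: induced_path_rev.
    by move=> i ik; apply: vp; clear -ik; lia.
  by move=> i ik; rewrite hv; clear -ik; lia.
- move=> hv; case: maxk; exists (fun i => if i < k then p i else v).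
  exact: induced_path_snoc.
Qed.

(** * Traces on an induced cycle *)

(** Reading the cycle periodically turns its subpaths into windows of consecutive naturals. *)
Definition wrap (T : Type) k (c : 'I_k.+1 -> T) : nat -> T :=
  fun i => c (inord (i %% k.+1)).

Lemma realizes_cycle_adj (G : sgraph) k (c : 'I_k.+1 -> G) :
  realizes (refl_closure (@cycle_rel k.+1)) c ->
  forall i j, closed_adj (wrap c i) (wrap c j) =
    [|| i == j %[mod k.+1], j == i.+1 %[mod k.+1] | i == j.+1 %[mod k.+1]].
Proof.
move=> hc i j; rewrite hc /refl_closure /cycle_rel -val_eqE /=.
rewrite !inordK ?ltn_pmod //; congr [|| _, _ | _].
  by rewrite -[(i %% k.+1).+1]addn1 modnDml addn1.
by rewrite -[(j %% k.+1).+1]addn1 modnDml addn1.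
Qed.

Lemma cycle_shift_path (G : sgraph) k (c : 'I_k.+1 -> G) s : 4 < k ->
  realizes (refl_closure (@cycle_rel k.+1)) c ->
  induced_path k (fun i => wrap c (s + i)).
Proof.
move=> k4 hc i j ik jk.
have cinj := realizes_inj (cycle_twin_free (leqW k4)) hc.
have eqc : (wrap c (s + i) == wrap c (s + j)) = (i == j).
  rewrite (inj_eq cinj) -val_eqE /= !inordK ?ltn_pmod // eqn_modDl.
  by rewrite !modn_small // ltnW.
split=> //; rewrite adjE eqc (realizes_cycle_adj hc) -!addnS !eqn_modDl.
by rewrite !modn_small ?ltnS // 1?ltnW //; clear; lia.
Qed.

(** The trace of [v] is a periodic sequence all of whose windows of length [k] obey the path
    classification. A window starting just after a gap leaves a block of three neighbours as the
    only possibility. *)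
Lemma cycle_nbhd (G : sgraph) m k (c : 'I_k.+1 -> G) (v : G) :
  ~ induced_subgraph K13 G -> ~ induced_subgraph (B1 m) G ->
  0 < m -> 3 * m <= k -> m + 4 <= k ->
  realizes (refl_closure (@cycle_rel k.+1)) c ->
  ~ (exists q : nat -> G, induced_path k.+1 q) ->
  (exists j, closed_adj v (c j)) ->
  exists i, forall j, closed_adj v (c j) = refl_closure (@cycle_rel k.+1) i j.
Proof.
move=> noK noB m0 mk3 mk4 hc maxk [j0 vj0].
have k4 : 4 < k by lia.
have [[i vi]|vnc] := classic (exists i, v = c i).
  by exists i => j; rewrite vi hc.
have vc i : v != c i by apply/eqP => vi; apply: vnc; exists i.
pose M i := adj v (wrap c i).
have Mper i : M (i + k.+1) = M i by rewrite /M /wrap modnDr.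
have wrapK (j : 'I_k.+1) : wrap c j = c j by rewrite /wrap modn_small ?inord_val.
have Mj (j : 'I_k.+1) : closed_adj v (c j) = M j.
  by rewrite /M wrapK /closed_adj (negbTE (vc j)).
have cls s : (exists2 i, i < k & M (s + i)) ->
    (exists2 t, t < k &
       forall j, j < k -> M (s + j) = [|| t == j, j == t.+1 | t == j.+1]) \/
    (forall j, j < k -> M (s + j) = (j == 0) || (j == k.-1)).
  move=> exM; have hs := cycle_shift_path s k4 hc.
  apply: (path_nbhd_maximal noK noB m0 mk3 mk4 hs) => //.
  by move=> i ik; apply: vc.
have no_single_gap s : ~~ M s -> M s.+1 -> ~~ M s.+2 -> M (s + 3) -> False.
  move=> M0 M1 M2 M3; have [|[t tk ht]|ht] := cls s.
  - by exists 1; rewrite ?addn1 //; clear -k4; lia.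
  - move: (ht 0) (ht 1) (ht 2) (ht 3).
    rewrite addn0 addn1 addn2 (negbTE M0) M1 (negbTE M2) M3; clear -k4; lia.
  - by move: (ht 0) M0; rewrite addn0; clear -k4 => ->; lia.
have no_isolated_pair s : ~~ M s -> M s.+1 -> M s.+2 -> ~~ M (s + 3) -> False.
  move=> M0 M1 M2 M3; have [|[t tk ht]|ht] := cls s.
  - by exists 1; rewrite ?addn1 //; clear -k4; lia.
  - move: (ht 0) (ht 1) (ht 2) (ht 3).
    rewrite addn0 addn1 addn2 (negbTE M0) M1 M2 (negbTE M3); clear -k4; lia.
  - by move: (ht 0) M0; rewrite addn0; clear -k4 => ->; lia.
have [j1 Mj1] : exists j1, ~~ M j1.
  have [M0|] := boolP (M 0); last by exists 0.
  have [M2|] := boolP (M 2); last by exists 2.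
  have [M4|] := boolP (M 4); last by exists 4.
  have [|[t tk ht]|ht] := cls 0; first by exists 0 => //; clear -k4; lia.
  - move: (ht 0) (ht 2) (ht 4); rewrite !add0n M0 M2 M4; clear -k4; lia.
  - by move: (ht 2); rewrite add0n M2; clear -k4; lia.
have Mmul i n : M (i + n * k.+1) = M i.
  by elim: n => [|n IH]; rewrite ?addn0 // mulSnr addnA Mper.
(* Take the first neighbour found after the gap [j1]; modulo [k.+1], [s + k] is the position before
   [s]. *)
have [s Ms Msk] : exists2 s, M s & ~~ M (s + k).
  have ex : exists i, M (j1 + i).
    exists (j0 + j1 * k); rewrite addnCA -mulnS Mmul -Mj //.
  case: (ex_minnP ex) => i Mi mini; exists (j1 + i) => //.
  case: i Mi mini => [|i] Mi mini; first by rewrite addn0 (negbTE Mj1) in Mi.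
  rewrite addnS addSnnS Mper; apply/negP => /mini; by rewrite ltnn.
have wrap_mod i j : i = j %[mod k.+1] -> wrap c i = wrap c j by rewrite /wrap => ->.
suff Ms3 i : i < k -> M (s + i) = (i <= 2).
  (* [v] is a twin of the middle one of three consecutive neighbours. Since [k] is -1 modulo [k.+1],
     the [i] below is [j - s]. *)
  exists (inord (s.+1 %% k.+1)) => j.
  pose i := (j + s * k) %% k.+1.
  have ik : i < k.+1 by rewrite ltn_pmod.
  have ji : wrap c j = wrap c (s + i).
    by apply: wrap_mod; rewrite modnDmr addnCA -mulnS addnC modnMDl.
  have MjE : M j = (i <= 2).
    rewrite /M ji; have [lt|ge] := ltnP i k; first exact: Ms3.
    have -> : i = k by clear -ge ik; lia.
    by rewrite -/(M _) (negbTE Msk); clear -k4; lia.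
  rewrite Mj MjE -hc -/(wrap c s.+1) -(wrapK j) ji (realizes_cycle_adj hc).
  have -> : (s.+1 == s + i %[mod k.+1]) = (1 == i).
    by rewrite -[s.+1]addn1 eqn_modDl !modn_small //; clear -k4; lia.
  have -> : (s + i == s.+2 %[mod k.+1]) = (i == 2).
    by rewrite -[s.+2]addn2 eqn_modDl !modn_small //; clear -k4; lia.
  have -> : (s.+1 == (s + i).+1 %[mod k.+1]) = (0 == i).
    by rewrite -addSn -{1}[s.+1]addn0 eqn_modDl !modn_small.
  by clear; lia.
have [|[t tk ht]|ht] := cls s.
- by exists 0; rewrite ?addn0 //; clear -k4; lia.
- have t1 : t <= 1 by move: (ht 0); rewrite addn0 Ms; clear -k4; lia.
  case: t t1 tk ht => [|[|//]] _ tk ht; last first.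
    by move=> ik; rewrite ht //; clear; lia.
  (* For [t = 0] the neighbours [s], [s.+1] have a gap on either side. *)
  case: (no_isolated_pair (s + k)) => //.
  + by rewrite -addnS Mper.
  + by rewrite -addnS -addSn Mper -addn1 ht //; clear -k4; lia.
  + have -> : s + k + 3 = s + 2 + k.+1 by clear; lia.
    by rewrite Mper ht //; clear -k4; lia.
(* If the window meets [v] at both ends, [s + k] is a single gap between two neighbours. *)
- case: (no_single_gap (s + k.-2)).
  + by rewrite ht; clear -k4; lia.
  + by rewrite -addnS ht; clear -k4; lia.
  + by have -> : (s + k.-2).+2 = s + k by clear -k4; lia.
  + have -> : s + k.-2 + 3 = s + k.+1 by clear -k4; lia.
    by rewrite Mper.
Qed.

(** * Maximal induced paths and the equivalence *)

Lemma maximal_induced_path (G : sgraph) n (p : nat -> G) : induced_path n p ->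
  exists k, [/\ n <= k, exists q : nat -> G, induced_path k q
                & ~ exists q : nat -> G, induced_path k.+1 q].
Proof.
have card k (q : nat -> G) : induced_path k q -> k <= #|G|.
  move=> hq; rewrite -[k]card_ord; apply: (@leq_card _ _ (fun i : 'I_k => q i)).
  move=> i j /eqP; have [||-> _] := hq i j; rewrite ?ltn_ord //.
  by move/eqP/val_inj.
move: {2}(#|G| - n) (leqnn (#|G| - n)) => d.
elim: d n p => [|d IH] n p dn hp.
  exists n; split=> //; first by exists p.
  by case=> q /card; move: dn (card _ _ hp); clear; lia.
have [[q hq]|no] := classic (exists q : nat -> G, induced_path n.+1 q).
  have [|k [nk exk maxk]] := IH n.+1 q _ hq; first by move: dn; clear; lia.
  by exists k; split=> //; apply: ltnW.
by exists n; split=> //; exists p.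
Qed.

Lemma fat_of_maximal_path (G : sgraph) m k (p : nat -> G) :
  connected_graph G ->
  ~ induced_subgraph K13 G -> ~ induced_subgraph (B1 m) G ->
  0 < m -> 3 * m <= k -> m + 4 <= k -> induced_path k p ->
  ~ (exists q : nat -> G, induced_path k.+1 q) ->
  fat_path k G \/ fat_cycle k G.
Proof.
move=> conn noK noB m0 mk3 mk4 hp maxk; have k4 : 4 < k by lia.
have [exc|noc] := classic (exists c : 'I_k.+1 -> G,
  realizes (refl_closure (@cycle_rel k.+1)) c).
  right; split=> //; apply: (@twin_decomposition G k.+1 (@cycle_rel k.+1)) => //.
  - exact: ord0.
  - exact: refl_closure_sym (@cycle_rel_sym _).
  - exact: cycle_twin_free (leqW k4).
  - by move=> i; apply: cycle_rel_nbr; clear -k4; lia.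
  - by move=> i j s t hs hsi _ _; apply: (cycle_row_swap (leqW k4) hs hsi).
  - by move=> c hc v; exact: (cycle_nbhd noK noB m0 mk3 mk4 hc maxk).
left; split=> //; apply: (@twin_decomposition G k (@path_rel k)) => //.
- exact: (Ordinal (ltn_trans (isT : 0 < 4) k4)).
- exact: refl_closure_sym (@path_rel_sym _).
- by apply: path_twin_free; clear -k4; lia.
- by move=> i; apply: path_rel_nbr; clear -k4; lia.
(* Each of [i] and [j] would be third from an end at which the other is among the last two,
   impossible for [k > 4]. *)
- move=> i j s t hs hsi ht htj.
  have := path_row_swap k4 hs hsi; have := path_row_swap k4 ht htj.
  by clear -k4; lia.
- case: k k4 mk3 mk4 hp maxk noc => // k k4 mk3 mk4 hp maxk noc q hq v [j0 vj0].
  have [[i vi]|vnq] := classic (exists i, v = q i).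
    by exists i => j; rewrite vi hq.
  have vq i : v != q i by apply/eqP => vi; apply: vnq; exists i.
  have adjq j : closed_adj v (q j) = adj v (q (inord j)).
    by rewrite /closed_adj (negbTE (vq j)) inord_val.
  have hq' := realizes_induced_path (ltnW (ltnW k4)) hq.
  case: (path_nbhd_maximal noK noB m0 mk3 mk4 hq' maxk (v := v)) => //.
  + by exists j0; rewrite // -adjq.
  + move=> [t tk ht]; exists (Ordinal tk) => j.
    by rewrite adjq ht.
  + move=> hv; case: noc.
    exists (fun i : 'I_k.+2 => if i < k.+1 then q (inord i) else v).
    exact: cycle_close hq' (fun i _ => vq _) hv.
- by exists (fun i : 'I_k => p i); apply: induced_path_realizes.
Qed.

(** One vertex from each of the first [n] cliques gives the path. *)
Lemma clique_decomposition_path (G : sgraph) K n (r : rel 'I_K)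
    (L : 'I_K -> {set G}) (nK : n <= K) :
  clique_decomposition r L ->
  (forall i j : 'I_n, r (widen_ord nK i) (widen_ord nK j) = path_rel i j) ->
  induced_subgraph (path_graph n) G.
Proof.
move=> [nonempty disj _ hadj] hr.
have f_ex i : exists x, x \in L i by apply/set0Pn.
pose f i := xchoose (f_ex i); have fL i : f i \in L i := xchooseP (f_ex i).
have finj : injective f.
  move=> i j fij; have [//|/disj/disjointFr/(_ (fL i))] := eqVneq i j.
  by rewrite fij fL.
exists (fun i : 'I_n => f (widen_ord nK i)).
  by move=> i j /finj /(congr1 val) /= /val_inj.
move=> i j; rewrite (hadj _ _ _ _ (fL _) (fL _)) (inj_eq finj) hr /= /nat_adj.
by rewrite -!val_eqE /=; case: eqVneq.
Qed.

Theorem theorem1p4 (m : nat) (hm : 1 <= m) (G : sgraph)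
    (hconn : connected_graph G) (hfree : free [:: K13; B1 m] G) :
  ~ free [:: path_graph (maxn (3 * m) (m + 4))] G
  <-> fat_family (maxn (3 * m) (m + 4)) G.
Proof.
have noK : ~ induced_subgraph K13 G by apply: hfree; left.
have noB : ~ induced_subgraph (B1 m) G by apply: hfree; right; left.
set n := maxn _ _; have n3 : 3 * m <= n by rewrite leq_maxl.
have n4 : m + 4 <= n by rewrite leq_maxr.
split=> [nfree | [l nl fat] free_n].
  have [f finj fadj] : induced_subgraph (path_graph n) G.
    by apply: NNPP => no; apply: nfree => H [<-|[]].
  have hn : n.-1.+1 = n by clear -n4; lia.
  pose p i := f (cast_ord hn (inord i)).
  have hp : induced_path n p.
    move=> i j i_n j_n; rewrite (inj_eq finj) fadj /= /nat_adj -!val_eqE /=.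
    by rewrite !inordK ?hn //; split=> //; clear; lia.
  have [k [nk [q hq] maxk]] := maximal_induced_path hp.
  exists k => //; apply: (fat_of_maximal_path hconn noK noB hm _ _ hq maxk).
    exact: leq_trans nk.
  exact: leq_trans nk.
apply: (free_n _ (or_introl erefl)).
case: fat => [[l5 [L hL]] | [l5 [L hL]]].
  exact: (clique_decomposition_path (nK := nl) hL).
(* At most [l] of the [l.+1] cliques are used, so the adjacency closing the cycle never appears. *)
apply: (clique_decomposition_path (nK := leqW nl) hL) => i j /=.
by rewrite /path_rel !modn_small // ltnS (leq_trans _ nl).
Qed.
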